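(* Let $\lambda$ be a non-zero real number. For every integer $n\ge 0$, $$H_{n,\lambda}(x)=n!\sum_{l=0}^{[n/2]}\frac{2^{n-2l}\,(-1)_{l,\lambda}}{l!\,(n-2l)!}\,(x)_{n-2l,\lambda},$$ where $H_{n,\lambda}(x)$ are the degenerate Hermite polynomials and $[y]$ denotes the greatest integer not exceeding $y$.
   Context: Fix a non-zero real number $\lambda$. The degenerate falling factorials are $(x)_{0,\lambda}=1$ and $(x)_{n,\lambda}=x(x-\lambda)(x-2\lambda)\cdots(x-(n-1)\lambda)$ for $n\ge 1$. The degenerate exponential functions are $e_\lambda^x(t)=(1+\lambda t)^{x/\lambda}=\sum_{n\ge 0}(x)_{n,\lambda}\frac{t^n}{n!}$, regarded as formal power series in $t$. In particular $e_\lambda^{-1}(t)=(1+\lambda t)^{-1/\lambda}$. The degenerate Hermite polynomials $H_{n,\lambda}(x)$ $(n\ge 0)$ are defined by the generating function $$e_\lambda^{-1}(t^2)\, e_\lambda^{x}(2t)=\sum_{n=0}^\infty H_{n,\lambda}(x)\frac{t^n}{n!}.$$ *)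

(* Defs.v *)
From HB Require Import structures.
From mathcomp Require Import all_boot all_order all_algebra.
From mathcomp Require Import reals.

Set Implicit Arguments.
Unset Strict Implicit.
Unset Printing Implicit Defensive.

Import Order.TTheory GRing.Theory Num.Theory.
Local Open Scope ring_scope.

(* A formal power series in t is its coefficient sequence:
   f stands for \sum_n (f n) t^n. *)
Definition fps (R : Type) := nat -> R.

Section FormalPowerSeries.
Variable R : comNzRingType.
Implicit Types f g : fps R.

Definition fps_one : fps R := fun n => (n == 0%N)%:R.

Definition fps_monom (c : R) (m : nat) : fps R := fun n => c *+ (n == m).

Definition fps_mul f g : fps R := fun n => \sum_(i < n.+1) f i * g (n - i)%N.

Definition fps_exp f (k : nat) : fps R := iter k (fps_mul f) fps_one.

(* Substitution f(g(t)), meaningful when g has zero constant term: the powers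
   g^k with k > n then do not contribute to the coefficient of t^n. *)
Definition fps_comp f g : fps R :=
  fun n => \sum_(k < n.+1) f k * fps_exp g k n.

End FormalPowerSeries.

Section Degenerate.
Variable R : realType.
Implicit Types lam x : R.

Definition dfall lam x (n : nat) : R := \prod_(i < n) (x - i%:R * lam).

Definition dexp lam x : fps R := fun n => dfall lam x n / n`!%:R.

(* For nonzero lam, dexp lam x is the binomial series of
   (1 + lam t)^(x / lam). *)
Lemma dexp_binomial lam x n : lam != 0 ->
  dexp lam x n = (\prod_(i < n) (x / lam - i%:R)) / n`!%:R * lam ^+ n.
Proof.
move=> lam0; rewrite /dexp mulrAC; congr (_ / _).
rewrite -[X in lam ^+ X]card_ord -prodr_const -big_split /=.
by apply: eq_bigr => i _; rewrite mulrBl divfK.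
Qed.

(* The series e_lam^(-1)(t^2) e_lam^x(2t). *)
Definition dhermite_gf lam x : fps R :=
  fps_mul (fps_comp (dexp lam (-1)) (fps_monom 1 2))
          (fps_comp (dexp lam x) (fps_monom 2 1)).

Definition dhermite lam (n : nat) x : R := n`!%:R * dhermite_gf lam x n.

Lemma dhermite_gfE lam x n : dhermite_gf lam x n = dhermite lam n x / n`!%:R.
Proof. by rewrite /dhermite mulrAC divff ?mul1r // pnatr_eq0 -lt0n fact_gt0. Qed.

End Degenerate.

(* Main.v *)
Require Import Defs.
From HB Require Import structures.
From mathcomp Require Import all_boot all_order all_algebra.
From mathcomp Require Import reals.
From mathcomp Require Import ring.

Set Implicit Arguments.
Unset Strict Implicit.
Unset Printing Implicit Defensive.

Import Order.TTheory GRing.Theory Num.Theory.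
Local Open Scope ring_scope.

(** Substituting a monomial [c t^m] into a series rescales its coefficients and spreads them over
    the multiples of [m] ([fps_comp_monom]). Hence in the Cauchy product of the series at [t^2] and
    at [2t] only even indices [2 * l] survive: the first factor gives [dfall lam (-1) l / l!], the
    second [2^(n - 2l) * dfall lam x (n - 2l) / (n - 2l)!]. Reindexing by [l] ([sum_even_ord])
    yields the formula. *)

Lemma fps_exp_monom (R : comNzRingType) (c : R) (m k n : nat) :
  fps_exp (fps_monom c m) k n = c ^+ k *+ (n == k * m)%N.
Proof.
elim: k n => [|k IHk] n; first by rewrite expr0 mul0n.
rewrite [LHS]/(fps_mul _ (fps_exp _ k) n) /fps_mul /fps_monom.
under eq_bigr => i _ do rewrite IHk mulrnAl mulrb.
rewrite -big_mkcond /= mulSn exprS.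
(* Only the index [i = m] can contribute to the product, and it is in range exactly when [m <= n];
   otherwise [n] is also too small to equal [m + k * m]. *)
case: (leqP m n) => [le_mn | lt_nm].
  rewrite (big_pred1 (Ordinal (le_mn : m < n.+1)%N)) //= mulrnAr.
  by rewrite -(eqn_add2l m) subnKC.
rewrite big_pred0 => [|i].
  by rewrite ltn_eqF // ltn_addr.
by apply/negbTE; rewrite neq_ltn (leq_ltn_trans _ lt_nm) // -ltnS.
Qed.

(** Only the power [k] with [n = k * m] reaches [t^n]. As [m] is positive, this [k] is unique and at
    most [n], so the truncated sum contains it. *)
Lemma fps_comp_monom (R : comNzRingType) (f : fps R) (c : R) (m n : nat) :
  (0 < m)%N ->
  fps_comp f (fps_monom c m) n =
    if (m %| n)%N then f (n %/ m)%N * c ^+ (n %/ m) else 0.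
Proof.
move=> m0; rewrite /fps_comp.
under eq_bigr => k _ do rewrite fps_exp_monom mulrnAr mulrb.
rewrite -big_mkcond /=; case: ifPn => [m_n | /negP m'n].
  rewrite (big_pred1 (inord (n %/ m))) => [|k].
    by rewrite inordK // ltnS leq_div.
  by rewrite /= -val_eqE /= inordK ?ltnS ?leq_div // eqn_div // eq_sym.
rewrite big_pred0 // => k; apply/negP => /eqP n_km.
by apply: m'n; rewrite n_km dvdn_mull.
Qed.

Lemma sum_even_ord (V : nmodType) (n : nat) (F : nat -> V) :
  \sum_(i < n.+1 | (2 %| i)%N) F i = \sum_(0 <= l < (n./2).+1) F (2 * l)%N.
Proof.
rewrite -(big_mkord (fun i => 2 %| i)%N).
elim: n => [|n IHn]; first by rewrite big_mkcond !big_nat1.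
rewrite big_mkcond big_nat_recr //= -big_mkcond /= IHn uphalf_half dvdn2 /=.
(* Both sides gain a term exactly when [n] is odd, and then [n.+1 = 2 * (n./2).+1]. *)
case: (boolP (odd n)) => [odd_n | _]; last by rewrite addr0.
rewrite add1n [RHS]big_nat_recr //=; congr (_ + F _).
by rewrite mul2n doubleS -[in LHS](odd_double_half n) odd_n.
Qed.

Theorem theorem1 (R : realType) (lam : R) (hlam : lam != 0) (n : nat) (x : R) :
  dhermite lam n x =
    n`!%:R * \sum_(0 <= l < (n./2).+1)
               (2 ^+ (n - 2 * l) * dfall lam (-1) l) / (l`!%:R * (n - 2 * l)`!%:R)
               * dfall lam x (n - 2 * l).
Proof.
rewrite /dhermite /dhermite_gf /fps_mul; congr (_ * _).
under eq_bigr => i _.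
  rewrite !fps_comp_monom // dvd1n divn1 expr1n mulr1.
  rewrite (fun_if (fun y => y * _)) mul0r.
  over.
rewrite -big_mkcond.
(* The summand is given as a function on [nat]; at [i = 2 * l] the quotient [i %/ 2] collapses to
   [l]. *)
rewrite (sum_even_ord n (fun i =>
  dexp lam (-1) (i %/ 2)%N * (dexp lam x (n - i)%N * 2 ^+ (n - i)))).
apply: eq_bigr => l _.
by rewrite mulKn // /dexp invfM; ring.
Qed.
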